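(* (Uniform Boundedness Principle) Let $(X,\tau)$ be a barreled extended locally convex space and let $(Y,\sigma)$ be any extended locally convex space. Suppose $\mathcal{A}\subseteq\mathcal{L}(X,Y)$ is pointwise bounded, and suppose that for every continuous extended seminorm $q$ on $(Y,\sigma)$ there exists a continuous extended seminorm $p$ on $(X,\tau)$ such that $X_{fin}^p\subseteq T^{-1}\left(Y_{fin}^q\right)$ for all $T\in\mathcal{A}$. Then $\mathcal{A}$ is an equicontinuous family in $\mathcal{L}(X,Y)$.
   Context: Vector spaces are over $\mathbb{K}\in\{\mathbb{R},\mathbb{C}\}$. An extended seminorm on a vector space $X$ is a map $\rho:X\to[0,\infty]$ with $\rho(\alpha x)=|\alpha|\rho(x)$ (convention $0\cdot\infty=0$) and $\rho(x+y)\le\rho(x)+\rho(y)$. An extended locally convex space (elcs) is a vector space $X$ with a Hausdorff topology $\tau$ induced by a family $\mathcal{P}$ of extended seminorms, i.e. the sets $\{y\in X:\rho(y-x)<\epsilon\}$ ($\rho\in\mathcal{P}$, $x\in X$, $\epsilon>0$) form a subbase of $\tau$. An extended seminorm $\rho$ is continuous on an elcs iff $\{x:\rho(x)<\epsilon\}$ is a neighborhood of $0$ for every $\epsilon>0$. For an extended seminorm $\rho$ on $X$, $X_{fin}^\rho=\{x\in X:\rho(x)<\infty\}$. A barrel in an elcs is a closed, absolutely convex (balanced and convex), absorbing subset; an elcs is barreled if every barrel in it is a neighborhood of $0$. $\mathcal{L}(X,Y)$ denotes the collection of all continuous linear maps from $(X,\tau)$ to $(Y,\sigma)$. A subset $A$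 of an elcs $Y$ is bounded if for every neighborhood $U$ of $0$ there exist a finite set $F\subseteq Y$ and $r>0$ with $A\subseteq F+rU$. $\mathcal{A}\subseteq\mathcal{L}(X,Y)$ is pointwise bounded if $\{Tx:T\in\mathcal{A}\}$ is bounded in $(Y,\sigma)$ for every $x\in X$. $\mathcal{A}\subseteq\mathcal{L}(X,Y)$ is equicontinuous if for every neighborhood $V$ of $0$ in $(Y,\sigma)$ there exists a neighborhood $U$ of $0$ in $(X,\tau)$ such that $T(U)\subseteq V$ for all $T\in\mathcal{A}$. *)

(* Defs.v *)
From HB Require Import structures.
From mathcomp Require Import all_boot all_order all_algebra.
From mathcomp.real_closed Require Import complex.
From mathcomp Require Import all_classical all_reals all_analysis.

Set Implicit Arguments.
Unset Strict Implicit.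
Unset Printing Implicit Defensive.

Import Order.TTheory GRing.Theory Num.Theory.

Local Open Scope classical_set_scope.
Local Open Scope ring_scope.

(* The scalar field K is R or C = R[i]. MathComp's norm on R[i] takes its values
   in R[i], so the R-valued absolute value is carried along with the field. *)
Inductive real_or_complex (R : realType) :
    forall K : numFieldType, (K -> R) -> Prop :=
| real_scalars : @real_or_complex R R (fun a : R => `|a|)
| complex_scalars :
    @real_or_complex R R[i] (@ComplexField.Normc.normc R).

(* (0 * +oo = 0)%E holds in \bar R. *)
Definition extended_seminorm (R : realType) (K : numFieldType) (abs : K -> R)
    (X : lmodType K) (rho : X -> \bar R) : Prop :=
  [/\ forall x, (0 <= rho x)%E,
      forall a x, rho (a *: x) = ((abs a)%:E * rho x)%E
    & forall x y, (rho (x + y)%R <= rho x + rho y)%E].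

Definition seminorm_subbase (R : realType) (K : numFieldType) (X : lmodType K)
    (P : set (X -> \bar R)) : set (set X) :=
  [set B | exists rho x (e : R),
     [/\ P rho, 0 < e & B = [set y | (rho (y - x)%R < e%:E)%E]]].

(* X is a topological space and a vector space with no compatibility built in:
   scaling need not be jointly continuous in an elcs. *)
Definition elcs (R : realType) (K : numFieldType) (abs : K -> R)
    (X : preTopologicalLmodType K) : Prop :=
  hausdorff_space X /\
  exists2 P : set (X -> \bar R),
    forall rho, P rho -> extended_seminorm abs rho &
    forall U : set X, open U <->
      exists2 D : set (set X),
        D `<=` finI_from (seminorm_subbase P) id & \bigcup_(B in D) B = U.

Definition continuous_extended_seminorm (R : realType) (K : numFieldType)
    (abs : K -> R) (X : preTopologicalLmodType K) (rho : X -> \bar R) : Prop :=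
  extended_seminorm abs rho /\
  forall e : R, 0 < e -> nbhs (0 : X) [set x | (rho x < e%:E)%E].

Definition fin_subspace (R : realType) (K : numFieldType) (X : lmodType K)
    (rho : X -> \bar R) : set X := [set x | (rho x < +oo)%E].

(* Here and below a scalar r : K with 0 < r is a positive real, also if K = C. *)
Definition balanced (K : numFieldType) (X : lmodType K) (A : set X) : Prop :=
  forall (a : K) x, `|a| <= 1 -> A x -> A (a *: x).

Definition absorbing (K : numFieldType) (X : lmodType K) (A : set X) : Prop :=
  forall x, exists2 r : K, 0 < r & forall a : K, `|a| <= r -> A (a *: x).

Definition absolutely_convex (K : numFieldType) (X : lmodType K) (A : set X) :
    Prop :=
  balanced A /\ convex_set A.

Definition barrel (K : numFieldType) (X : preTopologicalLmodType K)
    (B : set X) : Prop :=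
  [/\ closed B, absolutely_convex B & absorbing B].

Definition barreled (K : numFieldType) (X : preTopologicalLmodType K) : Prop :=
  forall B : set X, barrel B -> nbhs (0 : X) B.

Definition elcs_bounded (K : numFieldType) (Y : preTopologicalLmodType K)
    (A : set Y) : Prop :=
  forall U : set Y, nbhs (0 : Y) U ->
    exists (F : set Y) (r : K),
      [/\ finite_set F, 0 < r
        & A `<=` [set f + r *: u | f in F & u in U]].

Definition continuous_linear_maps (K : numFieldType)
    (X Y : preTopologicalLmodType K) : set {linear X -> Y} :=
  [set T : {linear X -> Y} | continuous T].

Definition elcs_pointwise_bounded (K : numFieldType)
    (X Y : preTopologicalLmodType K) (A : set {linear X -> Y}) : Prop :=
  forall x : X, elcs_bounded [set (T : {linear X -> Y}) x | T in A].

Definition equicontinuous_family (K : numFieldType)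
    (X Y : preTopologicalLmodType K) (A : set {linear X -> Y}) : Prop :=
  forall V : set Y, nbhs (0 : Y) V ->
    exists2 U : set X, nbhs (0 : X) U &
      forall T : {linear X -> Y}, A T -> T @` U `<=` V.

Arguments continuous_linear_maps {K} X Y.

(* Main.v *)
(** For an extended seminorm [q] and a threshold [c], the polar-type set
    [{x | q (T x) <= c for all T in A}] absorbs only the vectors of the open
    subspace [fin p] provided by the hypothesis on finite subspaces.  Adding to
    its trace on [fin p] an algebraic complement [M] of [fin p] makes it
    absorbing everywhere, and it stays closed because the cosets of [fin p] are
    open.  The resulting barrel is a neighborhood of 0, and so is its
    intersection with [fin p], which is the trace we started from. *)
Require Import Defs.
From HB Require Import structures.
From mathcomp Require Import all_boot all_order all_algebra.
From mathcomp Require Import finmap.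
From mathcomp.real_closed Require Import complex.
From mathcomp Require Import all_classical all_reals all_analysis.

Import Order.TTheory GRing.Theory Num.Theory.

Local Open Scope classical_set_scope.
Local Open Scope ring_scope.

(** * Absolute values and extended seminorms over the two scalar fields *)

Section Scalars.
Context {R : realType} {K : numFieldType} {abs : K -> R}.
Hypothesis hK : real_or_complex abs.

(** This treats the real and complex cases at once: identities and inequalities for [abs] are pulled
    back along [f] from those for the norm of [K]. *)
Lemma real_or_complex_embedding : exists f : {rmorphism R -> K},
  {mono f : x y / x <= y} /\ forall a, f (abs a) = `|a|.
Proof.
case: K abs / hK; first by exists idfun.
exists (real_complex R); split; last by case.
by move=> x y; rewrite lecE /= eqxx.
Qed.

Lemma abs_ge0 a : 0 <= abs a.
Proof.
have [f [fle fabs]] := real_or_complex_embedding.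
by rewrite -fle rmorph0 fabs.
Qed.

Lemma le_abs a b : `|a| <= `|b| -> abs a <= abs b.
Proof.
have [f [fle fabs]] := real_or_complex_embedding.
by rewrite -!fabs fle.
Qed.

Lemma absD_ge0 a b : 0 <= a -> 0 <= b -> abs (a + b) = abs a + abs b.
Proof.
have [f [fle fabs]] := real_or_complex_embedding => a0 b0.
by apply: (fmorph_inj f); rewrite rmorphD !fabs !ger0_norm// addr_ge0.
Qed.

Lemma abs_surj (c : R) : 0 < c -> exists2 a : K, 0 < a & abs a = c.
Proof.
have [f [fle fabs]] := real_or_complex_embedding => c0.
have fc0 : 0 < f c by rewrite lt_def fmorph_eq0 gt_eqF//= -(rmorph0 f) fle ltW.
by exists (f c) => //; apply: (fmorph_inj f); rewrite fabs gtr0_norm.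
Qed.

Lemma abs1 : abs 1 = 1.
Proof.
have [f [fle fabs]] := real_or_complex_embedding.
by apply: (fmorph_inj f); rewrite fabs normr1 rmorph1.
Qed.

Lemma absN1 : abs (- 1) = 1.
Proof.
have [f [fle fabs]] := real_or_complex_embedding.
by apply: (fmorph_inj f); rewrite fabs normrN1 rmorph1.
Qed.

Lemma abs0 : abs 0 = 0.
Proof.
have [f [fle fabs]] := real_or_complex_embedding.
by apply: (fmorph_inj f); rewrite fabs normr0 rmorph0.
Qed.

Section Seminorm.
Context {X : lmodType K} {rho : X -> \bar R}.
Hypothesis hrho : extended_seminorm abs rho.

Lemma seminorm0 : rho 0 = 0%E.
Proof. by case: hrho => _ hZ _; rewrite -(scale0r 0) hZ abs0 mul0e. Qed.

Lemma seminormN x : rho (- x) = rho x.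
Proof. by case: hrho => _ hZ _; rewrite -scaleN1r hZ absN1 mul1e. Qed.

Lemma seminorm_sub_le x y : (rho x <= rho (x - y) + rho y)%E.
Proof. by case: hrho => _ _ hD; rewrite -{1}(subrK y x). Qed.

Lemma seminormZ_le a x : `|a| <= 1 -> (rho (a *: x) <= rho x)%E.
Proof.
case: hrho => h0 hZ _ a1; rewrite hZ -[leRHS]mul1e lee_wpmul2r// lee_fin.
by rewrite -abs1 le_abs// normr1.
Qed.

(** The weights [abs a] and [abs (1 - a)] are nonnegative and sum to 1, as [abs] is additive on
    nonnegative scalars. *)
Lemma seminorm_convex (c : \bar R) a x y : 0 <= a -> a <= 1 ->
  (rho x <= c -> rho y <= c -> rho (a *: x + (1 - a) *: y) <= c)%E.
Proof.
case: hrho => h0 hZ hD a0 a1 xc yc; have a1' : 0 <= 1 - a by rewrite subr_ge0.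
apply: le_trans (hD _ _) _; rewrite !hZ.
have abs_sum : abs a + abs (1 - a) = 1 by rewrite -absD_ge0// subrKC abs1.
rewrite -[leRHS]mul1e -abs_sum EFinD ge0_muleDl ?lee_fin ?abs_ge0//.
by apply: leeD; apply: lee_wpmul2l => //; rewrite lee_fin abs_ge0.
Qed.

End Seminorm.
End Scalars.

(** * Algebraic complements of subspaces *)

Definition linear_subspace {K : fieldType} {V : lmodType K} (S : set V) : Prop :=
  S 0 /\ forall a x y, S x -> S y -> S (a *: x + y).

Section Subspace.
Context {K : fieldType} {V : lmodType K}.
Implicit Types S L M : set V.

Lemma linear_subspaceZ S a x : linear_subspace S -> S x -> S (a *: x).
Proof. by move=> [S0 SD] Sx; rewrite -[_ *: _]addr0; exact: SD. Qed.

Lemma linear_subspaceD S x y : linear_subspace S -> S x -> S y -> S (x + y).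
Proof. by move=> [S0 SD] Sx Sy; rewrite -[x]scale1r; exact: SD. Qed.

Lemma linear_subspaceB S x y : linear_subspace S -> S x -> S y -> S (x - y).
Proof. by move=> [S0 SD] Sx Sy; rewrite addrC -scaleN1r; exact: SD. Qed.

(** By Zorn, take [M] maximal among the subspaces meeting [L] trivially; a vector outside [L + M]
    could be adjoined to [M]. *)
Lemma subspace_complement L : linear_subspace L ->
  exists2 M, linear_subspace M &
    (forall x, L x -> M x -> x = 0) /\
    forall x, exists u m, [/\ L u, M m & x = u + m].
Proof.
move=> hL.
(* [0] is not required to lie in [M], so that the union of the empty chain
   qualifies. *)
pose P := [set M : set V | (forall a x y, M x -> M y -> M (a *: x + y)) /\
                           forall x, L x -> M x -> x = 0].
have [F FP Ftot|M [[MD ML] Mmax]] := @Zorn_bigcup _ P.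
  split=> [a x y [C FC Cx] [D FD Dy]|x Lx [C FC Cx]].
    have [CD|DC] := Ftot _ _ FC FD.
      by exists D => //; apply: (FP _ FD).1 => //; exact: CD.
    by exists C => //; apply: (FP _ FC).1 => //; exact: DC.
  exact: (FP _ FC).2.
have M0 : M 0.
  apply: contrapT => nM0; apply: (Mmax [set 0]); last first.
    by split=> [a _ _ -> ->|//]; rewrite scaler0 addr0.
  have M_empty x : ~ M x.
    by move=> Mx; apply: nM0; rewrite -(addNr x) -scaleN1r; exact: MD.
  by split=> [x /M_empty//|/(_ 0 erefl)].
exists M => //; split=> // x; apply: contrapT => nx.
have nMx : ~ M x.
  by move=> Mx; apply: nx; exists 0, x; rewrite add0r; split=> //; exact: hL.1.
apply: (Mmax [set y | exists a m, M m /\ y = a *: x + m]).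
  split=> [m Mm|/(_ x) sub]; first by exists 0, m; rewrite scale0r add0r.
  by apply: nMx; apply: sub; exists 1, 0; rewrite scale1r addr0.
split=> [b _ _ [a [m [Mm ->]]] [a' [m' [Mm' ->]]]|y Ly [a [m [Mm yE]]]].
  exists (b * a + a'), (b *: m + m'); split; first exact: MD.
  by rewrite scalerDr scalerDl scalerA addrACA.
have [a0|a0] := eqVneq a 0.
  by apply: ML => //; rewrite yE a0 scale0r add0r.
(* Solving [yE] for [x] puts it in [L + M], against [nx]. *)
exfalso; apply: nx; exists (a^-1 *: y), (- a^-1 *: m); split.
- exact: linear_subspaceZ.
- exact: linear_subspaceZ.
- by rewrite yE scalerDr scalerA mulVf// scale1r scaleNr addrK.
Qed.

End Subspace.

Lemma fin_linear_subspace {R : realType} {K : numFieldType} {abs : K -> R}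
    (hK : real_or_complex abs) {X : lmodType K} {rho : X -> \bar R} :
  extended_seminorm abs rho -> linear_subspace (fin_subspace rho).
Proof.
move=> hrho; have [h0 hZ hD] := hrho.
split=> [|a x y]; rewrite /fin_subspace /= ?(seminorm0 hK hrho)// => x_fin y_fin.
apply: le_lt_trans (hD _ _) _; rewrite lte_add_pinfty// hZ.
have /fineK <- : rho x \is a fin_num by rewrite ge0_fin_numE.
by rewrite -EFinM ltry.
Qed.

(** * Neighbourhoods in the topology induced by extended seminorms *)

Section Topology.
Context {R : realType} {K : numFieldType} {abs : K -> R}.
Hypothesis hK : real_or_complex abs.
Context {X : preTopologicalLmodType K} {P : set (X -> \bar R)}.
Hypothesis hP : forall rho, P rho -> extended_seminorm abs rho.
Hypothesis hopen : forall U : set X, open U <->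
  exists2 D : set (set X),
    D `<=` finI_from (seminorm_subbase P) id & \bigcup_(B in D) B = U.

Lemma nbhs_ball rho x (e : R) : P rho -> 0 < e ->
  nbhs x [set y | (rho (y - x)%R < e%:E)%E].
Proof.
move=> Prho e0; set B := [set _ | _]; apply: open_nbhs_nbhs; split.
  apply/hopen; exists [set B]; last by rewrite bigcup_set1.
  move=> _ ->; exists [fset B]%fset; last by rewrite set_fset1 bigcap_set1.
  by move=> C; rewrite in_fset1 => /eqP ->; apply/mem_set; exists rho, x, e.
by rewrite /B /= subrr (seminorm0 hK (hP _ Prho)).
Qed.

(** A basic neighbourhood of 0 is a finite intersection of balls with arbitrary centres; by the
    triangle inequality each of them contains a ball of the same seminorm centred at 0. *)
Lemma nbhs0_sub_filter (F : set_system X) : Filter F ->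
  (forall rho (e : R), P rho -> 0 < e -> F [set y | (rho y < e%:E)%E]) ->
  nbhs (0 : X) `<=` F.
Proof.
move=> FF Fball U; rewrite nbhsE => -[V [/hopen[D Dfin VE] V0] VU].
move: V0; rewrite -VE => -[B DB B0]; have [D' D'sub BE] := Dfin _ DB.
apply: (filterS (P := B)); first by move=> y By; apply: VU; rewrite -VE; exists B.
rewrite -BE; apply: filter_bigI => C CD'.
have /set_mem[rho [x [e [Prho e0 CE]]]] := D'sub _ CD'.
have rho_semi := hP _ Prho; have [rho0 _ rhoD] := rho_semi.
have : C 0 by rewrite -BE in B0; exact: B0.
rewrite CE /= sub0r (seminormN hK rho_semi) => rhox.
have rhox_fin : rho x \is a fin_num by rewrite ge0_fin_numE// (lt_trans rhox)// ltry.
move: rhox; rewrite -(fineK rhox_fin) lte_fin => rhox.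
apply: filterS (Fball rho (e - fine (rho x)) Prho _); last by rewrite subr_gt0.
move=> y /=; rewrite EFinB lteBrDr//; apply: le_lt_trans.
by rewrite fineK// -[in leRHS](seminormN hK rho_semi x).
Qed.

(** Continuity of translations is not part of the type of [X]; it comes from the subbase having
    balls around every point. *)
Lemma cvg_subr_0 (x : X) : (fun y => y - x) @ x --> (0 : X).
Proof. by apply: nbhs0_sub_filter => rho e Prho e0; exact: nbhs_ball. Qed.

End Topology.

(** * Uniform bounds for a single seminorm *)

Lemma bounded_seminorm {R : realType} {K : numFieldType} {abs : K -> R}
    (hK : real_or_complex abs) {Y : preTopologicalLmodType K} {q : Y -> \bar R}
    (hq : continuous_extended_seminorm abs q) {B : set Y} :
  elcs_bounded B -> B `<=` fin_subspace q ->
  exists2 C : R, 0 < C & forall y, B y -> (q y <= C%:E)%E.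
Proof.
have [q_semi qcont] := hq; have [q0 qZ qD] := q_semi.
move=> /(_ _ (qcont 1 ltr01))[F [r [/finite_seqP[s ->] r0 Bsub]]] Bfin.
(* [fine] sends [+oo] to 0, so centres with infinite [q] add nothing; the final 1 makes the bound
   positive. *)
exists (\sum_(f <- s) fine (q f) + abs r + 1).
  rewrite ltr_wpDl// addr_ge0 ?(abs_ge0 hK)// sumr_ge0// => f _.
  exact: fine_ge0.
move=> y By; have [f /= fs [u /= u1 yE]] := Bsub _ By.
have qru : (q (r *: u) <= (abs r)%:E)%E.
  by rewrite qZ -[leRHS]mule1 lee_wpmul2l ?lee_fin ?(abs_ge0 hK)// ltW.
(* A centre that is really used differs from [y], where [q] is finite, by [r *: u] with [q] at most
   [abs r]. *)
have qf_fin : q f \is a fin_num.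
  rewrite ge0_fin_numE//; have -> : f = y - r *: u by rewrite -yE addrK.
  apply: le_lt_trans (qD _ _) _; rewrite (seminormN hK q_semi).
  apply: lte_add_pinfty; first exact: Bfin.
  by apply: le_lt_trans qru _; rewrite ltry.
rewrite -yE; apply: le_trans (qD _ _) _.
apply: (@le_trans _ _ (fine (q f) + abs r)%:E).
  by rewrite EFinD fineK// leeD2l.
rewrite lee_fin -addrA lerD ?lerDl// (big_rem f)//= lerDl sumr_ge0// => g _.
exact: fine_ge0.
Qed.

(** [qball] provides balls around every point of [Y]: closedness of the barrel uses continuity of
    each [T] away from 0. *)
Lemma equicontinuous_for_seminorm {R : realType} {K : numFieldType}
    {abs : K -> R} (hK : real_or_complex abs)
    {X Y : preTopologicalLmodType K} (hX : elcs abs X)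
    (hXbarreled : barreled X) {A : set {linear X -> Y}}
    (hA : A `<=` continuous_linear_maps X Y) (hApb : elcs_pointwise_bounded A)
    {q : Y -> \bar R} (hq : continuous_extended_seminorm abs q)
    (qball : forall y (e : R), 0 < e ->
       nbhs y [set z | (q (z - y)%R < e%:E)%E])
    {p : X -> \bar R} (hp : continuous_extended_seminorm abs p)
    (hfin : forall T : {linear X -> Y}, A T ->
       fin_subspace p `<=` T @^-1` fin_subspace q) (c : R) :
  0 < c ->
  nbhs (0 : X) [set x | forall T : {linear X -> Y}, A T -> (q (T x) <= c%:E)%E].
Proof.
move=> c0.
have [_ [PX hPX openX]] := hX.
have [p_semi pcont] := hp; have [q_semi _] := hq; have [q0 qZ qD] := q_semi.
have pL := fin_linear_subspace hK p_semi.
have [M hM [LM decomp]] := subspace_complement _ pL.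
pose E := [set x | fin_subspace p x /\
  forall T : {linear X -> Y}, A T -> (q (T x) <= c%:E)%E].
pose B := [set x | exists u m, [/\ E u, M m & x = u + m]].
have nbhs_fin x : nbhs x [set y | fin_subspace p (y - x)].
  apply: (cvg_subr_0 hK hPX openX x); apply: filterS (pcont 1 ltr01) => y /= yp.
  by rewrite /fin_subspace /= (lt_trans yp)// ltry.
suff : barrel B.
  move=> /hXbarreled B_nbhs; apply: filterS2 B_nbhs (nbhs_fin 0).
  move=> x /= [u [m [[Lu uc] Mm xE]]]; rewrite subr0 => Lx T AT.
  (* Both [x] and [u] lie in [fin_subspace p], hence so does [m], which is also in [M]. *)
  suff m0 : m = 0 by rewrite xE m0 addr0; exact: uc.
  apply: LM => //; have -> : m = x - u by rewrite xE addrC addKr.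
  exact: linear_subspaceB.
split.
- rewrite -openC openE => x nBx.
  have [u [m [Lu Mm xE]]] := decomp x.
  have [T AT Tu] : exists2 T : {linear X -> Y}, A T & ~ (q (T u) <= c%:E)%E.
    apply: contrapT => nT; apply: nBx; exists u, m; split=> //; split=> // T AT.
    by apply: contrapT => nTu; apply: nT; exists T.
  have LTu : q (T u) \is a fin_num by rewrite ge0_fin_numE//; exact: hfin.
  (* This excess serves as radius: moving [T u] by less than it keeps [q] above [c]. *)
  have e0 : 0 < fine (q (T u)) - c.
    by rewrite subr_gt0 -lte_fin fineK// ltNge; exact/negP.
  apply: filterS2 (nbhs_fin x) (hA _ AT x _ (qball (T x) _ e0)).
  move=> y /= Lyx Tyx [v [n [[Lv vc] Mn yE]]].
  (* As [y - x] is in [fin_subspace p], the points [x] and [y] have the same component in [M], so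
     [y - x] is the difference of their components in [fin_subspace p]. *)
  have mn : m - n = 0.
    apply: LM; last exact: linear_subspaceB.
    have -> : m - n = v - (y - x) - u.
      by rewrite opprB yE xE opprD addrACA [v + _]addrA subrKC addrAC subrr add0r.
    by do 2![apply: linear_subspaceB => //].
  have yxvu : y - x = v - u.
    move/eqP: mn; rewrite subr_eq0 => /eqP mn.
    by rewrite yE xE mn opprD addrACA subrr addr0.
  move: Tyx; rewrite -linearB yxvu linearB => Tvu.
  have := seminorm_sub_le q_semi (T u) (T v).
  apply/negP; rewrite -ltNge -opprB (seminormN hK q_semi).
  rewrite -[ltRHS](fineK LTu) -[fine (q (T u))](subrK c) EFinD.
  apply: lte_leD => //; last exact: vc.
  by rewrite ge0_fin_numE//; exact: hfin.
- split.
    move=> a x a1 [u [m [[Lu uc] Mm ->]]].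
    exists (a *: u), (a *: m); rewrite scalerDr; split=> //; last first.
      exact: linear_subspaceZ.
    split=> [|T AT]; first exact: linear_subspaceZ.
    rewrite linearZ; apply: le_trans (uc _ AT).
    exact: (seminormZ_le hK q_semi).
  move=> x y t /set_mem[u [m [[Lu uc] Mm ->]]] /set_mem[v [n [[Lv vc] Mn ->]]].
  apply/mem_set; exists (t%:num *: u + (1 - t%:num) *: v).
  exists (t%:num *: m + (1 - t%:num) *: n); split.
  + split; first by apply: linear_subspaceD => //; exact: linear_subspaceZ.
    move=> T AT; rewrite linearD !linearZ.
    by apply: (seminorm_convex hK q_semi) => //; [exact: uc|exact: vc].
  + by apply: linear_subspaceD => //; exact: linear_subspaceZ.
  + by rewrite addrACA -!scalerDr.
- move=> x; have [u [m [Lu Mm xE]]] := decomp x.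
  have [|C C0 hC] := bounded_seminorm hK hq (hApb u).
    by move=> _ [T AT <-]; exact: hfin.
  (* Only the component [u] has to be scaled, from the bound [C] down to [c]; [M] absorbs [m] at any
     scale. *)
  have [r r0 rE] := abs_surj hK _ (divr_gt0 c0 C0).
  exists r => // a ar; exists (a *: u), (a *: m).
  rewrite xE scalerDr; split=> //; last exact: linear_subspaceZ.
  split=> [|T AT]; first exact: linear_subspaceZ.
  rewrite linearZ qZ; apply: (@le_trans _ _ ((c / C)%:E * C%:E)%E).
    apply: lee_pmul => //; rewrite ?lee_fin ?(abs_ge0 hK)//.
      by rewrite -rE (le_abs hK)// (gtr0_norm r0).
    by apply: hC; exists T.
  by rewrite -EFinM divfK ?gt_eqF.
Qed.

Theorem theorem5p12 (R : realType) (K : numFieldType) (abs : K -> R)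
    (hK : real_or_complex abs) (X Y : preTopologicalLmodType K)
    (hX : elcs abs X) (hXbarreled : barreled X) (hY : elcs abs Y)
    (A : set {linear X -> Y}) (hA : A `<=` continuous_linear_maps X Y)
    (hApb : elcs_pointwise_bounded A)
    (hfin : forall q : Y -> \bar R, continuous_extended_seminorm abs q ->
       exists2 p : X -> \bar R, continuous_extended_seminorm abs p &
         forall T : {linear X -> Y}, A T ->
           fin_subspace p `<=` T @^-1` fin_subspace q) :
  equicontinuous_family A.
Proof.
have [_ [PY hPY openY]] := hY.
(* The sets [V] for which the equicontinuity condition holds form a filter, so it is enough to test
   balls of one defining seminorm at a time. *)
pose F : set_system Y := [set V | nbhs (0 : X)
  [set x | forall T : {linear X -> Y}, A T -> V (T x)]].
have FF : Filter F.
  split; rewrite /F /=; first by apply: nearW.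
  - by move=> V W /=; apply: filterS2 => x Vx Wx T AT; split; [exact: Vx|exact: Wx].
  - by move=> V W VW /=; apply: filterS => x Vx T AT; apply: VW; exact: Vx.
suff sub : nbhs (0 : Y) `<=` F.
  move=> V /sub FV; eexists; first exact: FV.
  by move=> T AT _ [x hx <-]; exact: hx.
apply: (nbhs0_sub_filter hK hPY openY) => q e Pq e0.
have qball y d : 0 < d -> nbhs y [set z | (q (z - y)%R < d%:E)%E].
  by move=> d0; exact: (nbhs_ball hK hPY openY).
have hq : continuous_extended_seminorm abs q.
  split=> [|d d0]; first exact: hPY.
  by apply: filterS (qball 0 d d0) => y /=; rewrite subr0.
have [p hp pfin] := hfin q hq.
(* Halving turns the non-strict bound of the lemma into the strict one of an open ball. *)
have e20 : 0 < e / 2 by rewrite divr_gt0.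
apply: filterS (equicontinuous_for_seminorm hK hX hXbarreled hA hApb hq qball
  hp pfin _ e20) => x hx T AT /=.
apply: le_lt_trans (hx T AT) _.
by rewrite lte_fin ltr_pdivrMr// ltr_pMr// ltr1n.
Qed.
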